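(* There is an absolute constant $C>0$ such that for every $\epsilon$ with $0<\epsilon<2$ there exist an integer $d\le 2^{C(\log_2\frac{4}{\epsilon})^2}$ and a PPT state $\rho'$ on $\mathbb{C}^d\otimes\mathbb{C}^d$ with \[ {\rm dist}(\rho',\mathcal{SEP})\ \ge\ 2-\epsilon . \] Moreover, one may take $\rho'=\rho^{\otimes l}$ with $l=\lceil\log_2\frac4\epsilon\rceil$, $d_s=\lceil(\frac{4l}{\epsilon}-1)^2\rceil$, $d=(2d_s)^l$, where $\rho$ is the following state on $\mathbb{C}^2_A\otimes\mathbb{C}^2_B\otimes\mathbb{C}^{d_s}_{A'}\otimes\mathbb{C}^{d_s}_{B'}$: fix a unitary $U=(u_{ij})$ of size $d_s$ with $|u_{ij}|=1/\sqrt{d_s}$ for all $i,j$, put \[ X=\frac{1}{d_s\sqrt{d_s}}\sum_{i,j=1}^{d_s}u_{ij}|ij\rangle\langle ji|,\quad Y=\frac1{d_s}\sum_{i,j=1}^{d_s}u_{ij}|ii\rangle\langle jj|,\quad p=\frac{1}{1+\sqrt{d_s}}, \] and let, in block form with respect to the basis $|00\rangle,|01\rangle,|10\rangle,|11\rangle$ of $AB$, \[ \rho=\frac12\begin{pmatrix} (1-p)\sqrt{XX^\dagger} & 0 & 0 & (1-p)X\\ 0 & p\sqrt{YY^\dagger} & pY & 0\\ 0 & pY^\dagger & p\sqrt{Y^\dagger Y} & 0\\ (1-p)X^\dagger & 0 & 0 & (1-p)\sqrt{X^\dagger X} \end{pmatrix}; \] the state $\rho^{\otimes l}$ is regarded as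 a bipartite state on $\mathbb{C}^d\otimes\mathbb{C}^d$ with $\mathbb{C}^d=(\mathbb{C}^2\otimes\mathbb{C}^{d_s})^{\otimes l}$ being the $(AA')^{\otimes l}$ part and the other factor the $(BB')^{\otimes l}$ part.
   Context: A state is a positive semidefinite operator of trace one. For a bipartite system $\mathbb{C}^d\otimes\mathbb{C}^d$, a state is PPT if its partial transpose $({\rm Id}\otimes T)(\rho)$ is positive semidefinite, and $\mathcal{SEP}$ is the set of separable states (convex combinations of product states). The trace norm is $\|Z\|_1={\rm Tr}\sqrt{ZZ^\dagger}$ and ${\rm dist}(\rho,\mathcal{SEP})=\min_{\sigma\in\mathcal{SEP}}\|\rho-\sigma\|_1$. Logarithms are base $2$. *)

(* Defs.v *)
From HB Require Import structures.
From mathcomp Require Import all_boot all_order all_algebra.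
From mathcomp Require Import all_classical all_reals all_analysis.
From mathcomp Require Import complex mxtens.

Set Implicit Arguments.
Unset Strict Implicit.
Unset Printing Implicit Defensive.

Import Order.TTheory GRing.Theory Num.Theory.
Local Open Scope ring_scope.
Local Open Scope complex_scope.
Local Open Scope classical_set_scope.

Section QI.
Variable R : realType.
Local Notation C := R[i].

Definition adjmx m n (A : 'M[C]_(m, n)) : 'M[C]_(n, m) := (map_mx conjc A)^T.

Definition psd n (A : 'M[C]_n) : Prop :=
  adjmx A = A /\ forall v : 'cV[C]_n, 0 <= (adjmx v *m A *m v) 0 0.

Definition is_state n (A : 'M[C]_n) : Prop := psd A /\ \tr A = 1.

Definition sqrtm n (A : 'M[C]_n) : 'M[C]_n :=
  xget 0 [set S : 'M[C]_n | psd S /\ S *m S = A].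

Definition trnorm n (Z : 'M[C]_n) : R := complex.Re (\tr (sqrtm (Z *m adjmx Z))).

(* Bipartite operators on C^m (x) C^n are 'M_(m * n), with the product
   basis |a b> indexed by mxtens_index (a, b), the convention of tensmx. *)

Definition ptrans m n (A : 'M[C]_(m * n)) : 'M[C]_(m * n) :=
  \matrix_(i, j)
    A (mxtens_index ((mxtens_unindex i).1, (mxtens_unindex j).2))
      (mxtens_index ((mxtens_unindex j).1, (mxtens_unindex i).2)).

Definition is_PPT m n (A : 'M[C]_(m * n)) : Prop := psd (ptrans A).

Definition SEP m n : set 'M[C]_(m * n) :=
  [set sigma | exists (k : nat) (w : 'I_k -> R)
                 (A : 'I_k -> 'M[C]_m) (B : 'I_k -> 'M[C]_n),
     [/\ (forall i, 0 <= w i), \sum_(i < k) w i = 1,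
         (forall i, is_state (A i) /\ is_state (B i)) &
         sigma = \sum_(i < k) (w i)%:C *: (A i *t B i)]].

Definition distSEP m n (rho : 'M[C]_(m * n)) : R :=
  inf [set trnorm (rho - sigma) | sigma in @SEP m n].

Definition regroup_index m n p q (k : 'I_((m * p) * (n * q))) : 'I_((m * n) * (p * q)) :=
  let x := (mxtens_unindex k).1 in let y := (mxtens_unindex k).2 in
  mxtens_index (mxtens_index ((mxtens_unindex x).1, (mxtens_unindex y).1),
                mxtens_index ((mxtens_unindex x).2, (mxtens_unindex y).2)).

Definition regroup m n p q (M : 'M[C]_((m * n) * (p * q))) : 'M[C]_((m * p) * (n * q)) :=
  \matrix_(i, j) M (regroup_index i) (regroup_index j).

(* tensor product of bipartite operators, as a bipartite operator:
   (A on X1|Y1) (x) (B on X2|Y2) = operator on (X1 X2)|(Y1 Y2) *)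
Definition btens m n p q (A : 'M[C]_(m * n)) (B : 'M[C]_(p * q)) : 'M[C]_((m * p) * (n * q)) :=
  regroup (A *t B).

Definition tpow_cast n k : ((n ^ k * n) * (n ^ k * n) = n ^ k.+1 * n ^ k.+1)%N :=
  congr2 muln (esym (expnSr n k)) (esym (expnSr n k)).

Fixpoint tpow n (rho : 'M[C]_(n * n)) (l : nat) : 'M[C]_(n ^ l * n ^ l) :=
  match l with
  | 0 => 1%:M
  | k.+1 => castmx (tpow_cast n k, tpow_cast n k) (btens (tpow rho k) rho)
  end.

Definition flat_unitary ds (U : 'M[C]_ds) : Prop :=
  U *m adjmx U = 1%:M /\
  forall i j, `|U i j| = ((Num.sqrt (ds%:R : R))^-1)%:C.

Definition kb2 ds (i j k l : 'I_ds) : 'M[C]_(ds * ds) :=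
  delta_mx (mxtens_index (i, j)) (mxtens_index (k, l)).

Definition Xop ds (U : 'M[C]_ds) : 'M[C]_(ds * ds) :=
  ((ds%:R * Num.sqrt (ds%:R : R))^-1)%:C *: \sum_(i < ds) \sum_(j < ds) U i j *: kb2 i j j i.

Definition Yop ds (U : 'M[C]_ds) : 'M[C]_(ds * ds) :=
  ((ds%:R : R)^-1)%:C *: \sum_(i < ds) \sum_(j < ds) U i j *: kb2 i i j j.

Definition pparam (ds : nat) : R := (1 + Num.sqrt (ds%:R : R))^-1.

Definition kbAB (a b c e : 'I_2) : 'M[C]_(2 * 2) :=
  delta_mx (mxtens_index (a, b)) (mxtens_index (c, e)).

(* rho as an operator on (A B) (x) (A' B'), in the block form of the paper *)
Definition rho_ABAB ds (U : 'M[C]_ds) : 'M[C]_((2 * 2) * (ds * ds)) :=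
  let X := Xop U in let Y := Yop U in let p := pparam ds in
  let o : 'I_2 := 0 in let l : 'I_2 := 1 in
  (2^-1)%:C *:
   (((1 - p)%:C) *: (kbAB o o o o *t sqrtm (X *m adjmx X) + kbAB o o l l *t X
                    + kbAB l l o o *t adjmx X + kbAB l l l l *t sqrtm (adjmx X *m X))
  + (p%:C) *: (kbAB o l o l *t sqrtm (Y *m adjmx Y) + kbAB o l l o *t Y
                    + kbAB l o o l *t adjmx Y + kbAB l o l o *t sqrtm (adjmx Y *m Y))).

(* rho as a bipartite operator on (A A') (x) (B B') *)
Definition rho_state ds (U : 'M[C]_ds) : 'M[C]_((2 * ds) * (2 * ds)) :=
  regroup (rho_ABAB U).

Definition log2 (x : R) : R := ln x / ln 2.

Definition l_of (eps : R) : nat := `|Num.ceil (log2 (4 / eps))|%N.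
Definition ds_of (eps : R) : nat := `|Num.ceil ((4 * (l_of eps)%:R / eps - 1) ^+ 2)|%N.

End QI.

(* Main.v *)
(* The restriction of rho to the |00>,|11> block of AB is 1 - p times the
   normalized projector P = H H^dag onto the vectors
     (|00>|ij> + conj(w_ij) |11>|ji>) / sqrt 2,   w_ij = sqrt d_s u_ij,
   and the partial transpose exchanges the two off-diagonal blocks of rho, so
   that rho is invariant under it for the chosen p.  Hence rho^(x)l is an
   invariant state with overlap (1 - p)^l with P^(x)l.  A product vector a (x) b
   has overlap at most 2^-l |a|^2 |b|^2 with P^(x)l: conditioning on one AB pair,
   the l-th overlap is half of the sum over i, j of the (l-1)-th overlaps of
   a_0i (x) b_0j + w_ij a_1j (x) b_1i, and Cauchy-Schwarz applies.
   The observable 2 P^(x)l - 1 then gives the trace distance lower bound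
   2 ((1 - p)^l - 2^-l) >= 2 - eps. *)

Require Import Defs.
From HB Require Import structures.
From mathcomp Require Import all_boot all_order all_algebra.
From mathcomp Require Import all_classical all_reals all_analysis.
From mathcomp Require Import complex mxtens.
From mathcomp Require Import spectral cyclic separable cyclotomic ring lra.

Import Order.TTheory GRing.Theory Num.Theory.
Local Open Scope ring_scope.
Local Open Scope complex_scope.

Set Implicit Arguments.
Unset Strict Implicit.
Unset Printing Implicit Defensive.

(** * Adjoints, squared moduli and the Frobenius norm *)

Section Adjoint.
Context {R : realType}.
Local Notation C := R[i].

Lemma adjmxE m n (A : 'M[C]_(m, n)) i j : adjmx A i j = conjc (A j i).
Proof. by rewrite !mxE. Qed.

Lemma adjmxK m n (A : 'M[C]_(m, n)) : adjmx (adjmx A) = A.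
Proof. by apply/matrixP => i j; rewrite !adjmxE conjcK. Qed.

Lemma adjmxM m n p (A : 'M[C]_(m, n)) (B : 'M[C]_(n, p)) :
  adjmx (A *m B) = adjmx B *m adjmx A.
Proof. by rewrite /adjmx map_mxM trmx_mul. Qed.

Lemma adjmxD m n (A B : 'M[C]_(m, n)) : adjmx (A + B) = adjmx A + adjmx B.
Proof. by apply/matrixP => i j; rewrite !mxE rmorphD. Qed.

Lemma adjmxN m n (A : 'M[C]_(m, n)) : adjmx (- A) = - adjmx A.
Proof. by apply/matrixP => i j; rewrite !mxE rmorphN. Qed.

Lemma adjmxZ m n (a : C) (A : 'M[C]_(m, n)) : adjmx (a *: A) = conjc a *: adjmx A.
Proof. by apply/matrixP => i j; rewrite !mxE rmorphM. Qed.

Lemma adjmxZr m n (a : R) (A : 'M[C]_(m, n)) : adjmx (a%:C *: A) = a%:C *: adjmx A.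
Proof. by rewrite adjmxZ conjc_real. Qed.

Lemma adjmx1 n : adjmx (1%:M : 'M[C]_n) = 1%:M.
Proof. by rewrite /adjmx map_mx1 trmx1. Qed.

Lemma adjmx_delta m n i j : adjmx (delta_mx i j : 'M[C]_(m, n)) = delta_mx j i.
Proof. by rewrite /adjmx map_delta_mx trmx_delta. Qed.

Lemma adjmx_tens m n p q (A : 'M[C]_(m, n)) (B : 'M[C]_(p, q)) :
  adjmx (A *t B) = adjmx A *t adjmx B.
Proof. by apply/matrixP => i j; rewrite !mxE rmorphM. Qed.

(** Valued in [R], so that inequalities live in a totally ordered field instead of the partially
    ordered [R[i]]. *)
Definition sqmod (z : C) : R := complex.Re z ^+ 2 + complex.Im z ^+ 2.

Lemma sqmodE z : (sqmod z)%:C = conjc z * z.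
Proof.
case: z => a b; rewrite /sqmod; apply/eqP; rewrite eq_complex /=.
by apply/andP; split; apply/eqP; ring.
Qed.

Lemma sqmod_ge0 z : 0 <= sqmod z.
Proof. by rewrite addr_ge0 ?sqr_ge0. Qed.

Lemma sqmod_eq0 z : sqmod z = 0 -> z = 0.
Proof.
move=> /eqP; rewrite /sqmod paddr_eq0 ?sqr_ge0// !sqrf_eq0.
by case: z => a b /= /andP[/eqP-> /eqP->].
Qed.

Lemma sqmodM x y : sqmod (x * y) = sqmod x * sqmod y.
Proof. by case: x y => a b [c d]; rewrite /sqmod /=; ring. Qed.

Lemma sqmod_real (a : R) : sqmod a%:C = a ^+ 2.
Proof. by rewrite /sqmod /= expr0n addr0. Qed.

Lemma norm_sqmod z : `|z| = (Num.sqrt (sqmod z))%:C.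
Proof. by rewrite normc_def. Qed.

(** The two sides differ by |t x - y|^2 / t. The free weight [t] stands in for Cauchy-Schwarz
    without square roots; it is chosen only after summation. *)
Lemma sqmodD x y t : 0 < t ->
  sqmod (x + y) <= (1 + t) * sqmod x + (1 + t^-1) * sqmod y.
Proof.
move=> t0; case: x y => a b [c d]; rewrite /sqmod /= -subr_ge0.
have -> : (1 + t) * (a ^+ 2 + b ^+ 2) + (1 + t^-1) * (c ^+ 2 + d ^+ 2) -
  ((a + c) ^+ 2 + (b + d) ^+ 2) = t^-1 * ((t * a - c) ^+ 2 + (t * b - d) ^+ 2).
  by field; rewrite gt_eqF.
by rewrite mulr_ge0 ?invr_ge0 ?(ltW t0)// addr_ge0 ?sqr_ge0.
Qed.

(** The squared Frobenius norm, serving both for vectors and for factors of psd matrices. *)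
Definition sqnorm m n (A : 'M[C]_(m, n)) : R := \sum_i \sum_j sqmod (A i j).

Lemma sqnorm_ge0 m n (A : 'M[C]_(m, n)) : 0 <= sqnorm A.
Proof. by apply: sumr_ge0 => i _; apply: sumr_ge0 => j _; exact: sqmod_ge0. Qed.

Lemma sqnorm_eq0 m n (A : 'M[C]_(m, n)) : sqnorm A = 0 -> A = 0.
Proof.
move=> /psumr_eq0P H; apply/matrixP => i j; rewrite mxE; apply: sqmod_eq0.
have /psumr_eq0P -> // : \sum_j sqmod (A i j) = 0.
  by apply: H => // k _; apply: sumr_ge0 => l _; exact: sqmod_ge0.
by move=> k _; exact: sqmod_ge0.
Qed.

Lemma mxtrace_adj_mul m n (A : 'M[C]_(m, n)) : \tr (adjmx A *m A) = (sqnorm A)%:C.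
Proof.
rewrite /sqnorm exchange_big rmorph_sum; apply: eq_bigr => j _.
by rewrite mxE rmorph_sum; apply: eq_bigr => i _; rewrite adjmxE -sqmodE.
Qed.

Lemma mxtrace_mul_adj m n (A : 'M[C]_(m, n)) : \tr (A *m adjmx A) = (sqnorm A)%:C.
Proof. by rewrite mxtrace_mulC mxtrace_adj_mul. Qed.

Lemma sqnorm_vec n (v : 'cV[C]_n) : (adjmx v *m v) 0 0 = (sqnorm v)%:C.
Proof. by rewrite -mxtrace_adj_mul /mxtrace big_ord1. Qed.

Lemma sqnormZ m n (a : C) (A : 'M[C]_(m, n)) : sqnorm (a *: A) = sqmod a * sqnorm A.
Proof.
rewrite /sqnorm mulr_sumr; apply: eq_bigr => i _.
by rewrite mulr_sumr; apply: eq_bigr => j _; rewrite mxE sqmodM.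
Qed.

Lemma sqnormD m n (A B : 'M[C]_(m, n)) t : 0 < t ->
  sqnorm (A + B) <= (1 + t) * sqnorm A + (1 + t^-1) * sqnorm B.
Proof.
move=> t0; rewrite /sqnorm !mulr_sumr -big_split; apply: ler_sum => i _.
rewrite !mulr_sumr -big_split; apply: ler_sum => j _.
by rewrite mxE sqmodD.
Qed.

End Adjoint.

(** * Spectral theorem, psd square roots and the trace norm *)

Lemma hermitian_diagonalization_closed (C : numClosedFieldType) n (A : 'M[C]_n) :
  (A ^t*)%sesqui = A ->
  exists (V : 'M[C]_n) (d : 'rV[C]_n),
    [/\ V *m (V ^t*)%sesqui = 1%:M, forall i, d 0 i \is Num.real &
        A = (V ^t*)%sesqui *m diag_mx d *m V].
Proof.
move=> hA.
have Ah : A \is hermsymmx by rewrite qualifE /= expr0 scale1r hA.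
have /orthomx_spectralP EA := hermitian_normalmx Ah.
have U := spectral_unitarymx A.
exists (spectralmx A), (spectral_diag A); split.
- exact/unitarymxP.
- by move=> i; have /mxOverP := hermitian_spectral_diag_real Ah; apply.
- by rewrite {1}EA invmx_unitary.
Qed.

Section PositiveSemidefinite.
Context {R : realType}.
Local Notation C := R[i].

Lemma psd_mul_adj m n (S : 'M[C]_(m, n)) : psd (S *m adjmx S).
Proof.
split=> [|v]; first by rewrite adjmxM adjmxK.
rewrite !mulmxA -mulmxA -[adjmx v *m S]adjmxK adjmxM adjmxK sqnorm_vec ler0c.
exact: sqnorm_ge0.
Qed.

Lemma hermitian_diagonalization n (A : 'M[C]_n) : adjmx A = A ->
  exists (V : 'M[C]_n) (d : 'rV[R]_n),
    V *m adjmx V = 1%:M /\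
    A = adjmx V *m diag_mx (map_mx (real_complex R) d) *m V.
Proof.
move=> hA.
have adjE m p (B : 'M[C]_(m, p)) : (B ^t*)%sesqui = adjmx B.
  by rewrite /adjmx map_trmx.
have [V [d [VV dreal EA]]] : exists (V : 'M[C]_n) (d : 'rV[C]_n),
    [/\ V *m (V ^t*)%sesqui = 1%:M, forall i, d 0 i \is Num.real &
        A = (V ^t*)%sesqui *m diag_mx d *m V].
  by apply: hermitian_diagonalization_closed; rewrite adjE.
exists V, (map_mx (@complex.Re R) d); split; first by rewrite -VV adjE.
have -> : map_mx (real_complex R) (map_mx (@complex.Re R) d) = d.
  by apply/matrixP => i j; rewrite !mxE (ord1 i) RRe_real.
by rewrite -adjE.
Qed.

Lemma mul_real_diag n (d e : 'rV[R]_n) :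
  diag_mx (map_mx (real_complex R) d) *m diag_mx (map_mx (real_complex R) e) =
  diag_mx (map_mx (real_complex R) (\row_i (d 0 i * e 0 i))).
Proof.
rewrite mulmx_diag; congr diag_mx; apply/matrixP => i j.
by rewrite !mxE rmorphM.
Qed.

Lemma adj_real_diag n (d : 'rV[R]_n) :
  adjmx (diag_mx (map_mx (real_complex R) d)) = diag_mx (map_mx (real_complex R) d).
Proof.
apply/matrixP => i j; rewrite !mxE eq_sym.
by case: eqVneq => [->|]; rewrite ?mulr1n ?mulr0n ?conjc_real ?conjc0.
Qed.

Lemma mulmx_isometry3 n (V D E : 'M[C]_n) : V *m adjmx V = 1%:M ->
  (adjmx V *m D *m V) *m (adjmx V *m E *m V) = adjmx V *m (D *m E) *m V.
Proof. by move=> VV; rewrite -!mulmxA (mulmxA V) VV mul1mx. Qed.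

Lemma psd_conj_diag n (V : 'M[C]_n) (d : 'rV[R]_n) : (forall i, 0 <= d 0 i) ->
  exists S : 'M[C]_n, adjmx V *m diag_mx (map_mx (real_complex R) d) *m V = S *m adjmx S.
Proof.
move=> d0.
exists (adjmx V *m diag_mx (map_mx (real_complex R) (\row_i Num.sqrt (d 0 i)))).
rewrite adjmxM adjmxK adj_real_diag mulmxA -[in RHS](mulmxA (adjmx V)) mul_real_diag.
congr (_ *m diag_mx _ *m _); apply/matrixP => i j.
by rewrite (ord1 i) !mxE -expr2 sqr_sqrtr.
Qed.

(** Each eigenvalue is the value of the quadratic form at the eigenvector [adjmx V *m delta_mx i 0],
    hence nonnegative. Positivity is mostly used below through this factorization. *)
Lemma psd_factor n (A : 'M[C]_n) : psd A -> exists S : 'M[C]_n, A = S *m adjmx S.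
Proof.
move=> [/hermitian_diagonalization[V [d [VV EA]]] A0].
rewrite EA; apply: psd_conj_diag => i.
have := A0 (adjmx V *m delta_mx i 0).
rewrite EA adjmxM adjmxK -!mulmxA (mulmxA V) VV mul1mx (mulmxA V) VV mul1mx.
rewrite adjmx_delta mulmxA -rowE -colE !mxE eqxx mulr1n.
by rewrite ler0c.
Qed.

(* If S^2 = T^2 then D := S - T satisfies D (S + T) + (S + T) D = 0, so
   D S D + D T D is traceless; both terms being psd, they vanish. *)
Lemma psd_sqrt_unique n (S T : 'M[C]_n) : psd S -> psd T ->
  S *m S = T *m T -> S = T.
Proof.
move=> pS pT ST.
set D := S - T.
have hD : adjmx D = D by rewrite adjmxD adjmxN pS.1 pT.1.
have E : D *m (S + T) = - ((S + T) *m D).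
  apply/eqP; rewrite -addr_eq0 /D !mulmxBl !mulmxDr !mulmxN !mulmxDl ST.
  by apply/eqP/matrixP => i j; rewrite !mxE; ring.
have tr0 : \tr (D *m S *m D) + \tr (D *m T *m D) = 0.
  rewrite -mxtraceD -mulmxDl -mulmxDr; apply/eqP.
  suff : \tr (D *m (S + T) *m D) = - \tr (D *m (S + T) *m D).
    by move=> /eqP; rewrite -addr_eq0 -mulr2n mulrn_eq0.
  by rewrite {1}E mulNmx raddfN /= mxtrace_mulC mulmxA.
have traceP X : psd X -> exists r : R,
    [/\ 0 <= r, \tr (D *m X *m D) = r%:C & r = 0 -> X *m D = 0].
  move=> /psd_factor[Y EY]; exists (sqnorm (adjmx Y *m D)).
  rewrite sqnorm_ge0 EY -mxtrace_adj_mul adjmxM adjmxK hD !mulmxA; split=> //.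
  by move=> /sqnorm_eq0; rewrite -mulmxA => ->; rewrite mulmx0.
have [s [s0 Es SD]] := traceP S pS.
have [t [t0 Et TD]] := traceP T pT.
move: tr0; rewrite Es Et -rmorphD => /complexI/eqP.
rewrite paddr_eq0 // => /andP[/eqP/SD {}SD /eqP/TD {}TD].
apply/eqP; rewrite -subr_eq0 -/D; apply/eqP/sqnorm_eq0/complexI.
by rewrite -mxtrace_adj_mul hD {1}/D mulmxBl SD TD subr0 mxtrace0.
Qed.

(** [sqrtm] selects a root by choice; uniqueness of the psd root makes any exhibited one its
    value. *)
Lemma sqrtm_eq n (A S : 'M[C]_n) : psd S -> S *m S = A -> sqrtm A = S.
Proof.
move=> pS SA; apply: xget_unique; first by [].
by move=> T [pT TA]; apply: psd_sqrt_unique => //; rewrite TA SA.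
Qed.

(** [Q] is the projector 1 - E E^dag, so Q = Q Q^dag has nonnegative diagonal; its entry at [i] is 1
    minus the row sum. *)
Lemma isometry_row_le1 n k (E : 'M[C]_(n, k)) i :
  adjmx E *m E = 1%:M -> \sum_j sqmod (E i j) <= 1.
Proof.
move=> EE.
pose Q := 1%:M - E *m adjmx E.
have QQ : Q = Q *m adjmx Q.
  rewrite /Q adjmxD adjmxN adjmx1 adjmxM adjmxK mulmxBl mul1mx mulmxBr mulmx1.
  by rewrite mulmxA -(mulmxA E) EE mulmx1 subrr subr0.
have := congr1 (fun X : 'M[C]_n => X i i) QQ.
rewrite {1}/Q !mxE eqxx /= mulr1n.
under eq_bigr do rewrite adjmxE mulrC -sqmodE.
under [X in _ = X]eq_bigr do rewrite adjmxE mulrC -sqmodE.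
rewrite -!rmorph_sum -(rmorph1 (real_complex R)) -rmorphB /= => /complexI Er.
by rewrite -subr_ge0 Er; apply: sumr_ge0 => j _; exact: sqmod_ge0.
Qed.

(** In the eigenbasis of [A] the trace norm is the sum of the |d_i|, while the trace on the left is
    the sum of d_i p_i, with p_i in [0, 1] the squared row norms of the isometry V H. *)
Lemma trnorm_ge n k (A : 'M[C]_n) (H : 'M[C]_(n, k)) : adjmx A = A -> \tr A = 0 ->
  adjmx H *m H = 1%:M -> 2 * complex.Re (\tr (adjmx H *m A *m H)) <= trnorm A.
Proof.
move=> hA trA HH.
have [V [d [VV EA]]] := hermitian_diagonalization hA.
have VV' := mulmx1C VV.
pose D e := adjmx V *m diag_mx (map_mx (real_complex R) e) *m V.
have trD e : \tr (D e) = (\sum_i e 0 i)%:C.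
  rewrite /D -mulmxA mxtrace_mulC -mulmxA VV mulmx1 mxtrace_diag rmorph_sum.
  by apply: eq_bigr => i _; rewrite mxE.
have psdS : psd (D (\row_i `|d 0 i|)).
  have [|S ES] := @psd_conj_diag _ V (\row_i `|d 0 i|); first by move=> i; rewrite mxE.
  by rewrite /D ES; exact: psd_mul_adj.
have SS : D (\row_i `|d 0 i|) *m D (\row_i `|d 0 i|) = A *m adjmx A.
  rewrite hA EA /D (mulmx_isometry3 _ _ VV) (mulmx_isometry3 _ _ VV).
  rewrite (mul_real_diag (\row_i `|d 0 i|)) (mul_real_diag d); congr (_ *m diag_mx _ *m _).
  by apply/matrixP => i j; rewrite !mxE -normrM ger0_norm // -expr2 sqr_ge0.
rewrite /trnorm (sqrtm_eq psdS SS) trD /=.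
pose E := V *m H.
have EE : adjmx E *m E = 1%:M by rewrite adjmxM mulmxA -(mulmxA _ _ V) VV' mulmx1.
have -> : \tr (adjmx H *m A *m H) = (\sum_i d 0 i * \sum_j sqmod (E i j))%:C.
  set Dd := diag_mx (map_mx (real_complex R) d) in EA.
  have -> : adjmx H *m A *m H = adjmx E *m Dd *m E by rewrite EA adjmxM !mulmxA.
  rewrite mxtrace_mulC mulmxA mxtrace_mulC /mxtrace rmorph_sum.
  apply: eq_bigr => i _; rewrite mul_diag_mx !mxE rmorphM /=; congr (_ * _).
  by rewrite rmorph_sum; apply: eq_bigr => j _; rewrite adjmxE mulrC -sqmodE.
have d0 : \sum_i d 0 i = 0 by move: trA; rewrite EA -/(D d) trD => /complexI.
(* Since the d_i sum to 0, the weights 2 p_i may be replaced by 2 p_i - 1, which lie in [-1, 1]. *)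
rewrite /= -[leLHS]subr0 -[X in _ - X]d0 mulr_sumr -sumrB; apply: ler_sum => i _.
rewrite mxE.
have := isometry_row_le1 i EE.
have : 0 <= \sum_j sqmod (E i j) by apply: sumr_ge0 => j _; exact: sqmod_ge0.
move: (\sum_j _) => p p0 p1.
by have [?|?] := ger0P (d 0 i); nra.
Qed.

End PositiveSemidefinite.

(** * Tensor products, regrouping, partial transpose and separable overlaps *)

Section TensorProducts.
Context {R : realType}.
Local Notation C := R[i].
Local Notation idx := mxtens_index.

Lemma big_mxtens (V : nmodType) m n (F : 'I_(m * n) -> V) :
  \sum_k F k = \sum_i \sum_j F (idx (i, j)).
Proof.
rewrite pair_big (reindex (@mxtens_index m n)) /=; first by apply: eq_bigr => -[].
by exists (@mxtens_unindex m n) => k _; rewrite (mxtens_indexK, mxtens_unindexK).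
Qed.

Lemma mxtens_index_eq m n (x y : 'I_m * 'I_n) : (idx x == idx y) = (x == y).
Proof. exact: (inj_eq (can_inj (@mxtens_indexK m n))). Qed.

Lemma mxtrace_tens m n (A : 'M[C]_m) (B : 'M[C]_n) : \tr (A *t B) = \tr A * \tr B.
Proof.
rewrite /mxtrace big_mxtens mulr_suml; apply: eq_bigr => i _.
by rewrite mulr_sumr; apply: eq_bigr => j _; rewrite tensmxE.
Qed.

Lemma tensmx1 m n : (1%:M : 'M[C]_m) *t (1%:M : 'M[C]_n) = 1%:M.
Proof.
apply/matrixP => k l; case: (mxtens_indexP k) => i j; case: (mxtens_indexP l) => i' j'.
by rewrite tensmxE !mxE mxtens_index_eq xpair_eqE -natrM mulnb.
Qed.

Lemma tensmxZr m n p q c (A : 'M[C]_(m, n)) (B : 'M[C]_(p, q)) :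
  A *t (c *: B) = c *: (A *t B).
Proof. by apply/matrixP => i j; rewrite !mxE mulrCA. Qed.

Lemma regroup_indexE m n p q (i : 'I_m) (j : 'I_n) (k : 'I_p) (l : 'I_q) :
  regroup_index (idx (idx (i, k), idx (j, l))) = idx (idx (i, j), idx (k, l)).
Proof. by rewrite /regroup_index !mxtens_indexK. Qed.

Lemma regroup_indexK m n p q :
  cancel (@regroup_index m n p q) (@regroup_index m p n q).
Proof.
move=> k; case: (mxtens_indexP k) => x y.
case: (mxtens_indexP x) => i i'; case: (mxtens_indexP y) => j j'.
by rewrite !regroup_indexE.
Qed.

Lemma big_regroup m n p q (F : 'I_((m * n) * (p * q)) -> C) :
  \sum_k F (@regroup_index m n p q k) = \sum_k F k.
Proof.
rewrite [RHS](reindex (@regroup_index m n p q)) //.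
by exists (@regroup_index m p n q) => k _; exact: regroup_indexK.
Qed.

(** The action on vectors of the coordinate permutation by which [regroup] conjugates operators; the
    columns label a family of vectors and stay in place. *)
Definition regroup_rows m n p q k (G : 'M[C]_((m * n) * (p * q), k)) :
  'M[C]_((m * p) * (n * q), k) := rowsub (@regroup_index m n p q) G.

Lemma regroup_mul_adj m n p q k (G H : 'M[C]_((m * n) * (p * q), k)) :
  regroup (G *m adjmx H) = regroup_rows G *m adjmx (regroup_rows H).
Proof.
apply/matrixP => i j; rewrite !mxE.
by apply: eq_bigr => l _; rewrite !mxE.
Qed.

Lemma regroup_adj_mul m n p q k l (G : 'M[C]_((m * n) * (p * q), k))
    (H : 'M[C]_((m * n) * (p * q), l)) :
  adjmx (regroup_rows G) *m regroup_rows H = adjmx G *m H.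
Proof.
apply/matrixP => i j; rewrite !mxE -[RHS]big_regroup.
by apply: eq_bigr => x _; rewrite !mxE.
Qed.

Lemma regroup_mul_rows m n p q k (M : 'M[C]_((m * n) * (p * q)))
    (G : 'M[C]_((m * n) * (p * q), k)) :
  regroup M *m regroup_rows G = regroup_rows (M *m G).
Proof.
apply/matrixP => i j; rewrite !mxE -[RHS]big_regroup.
by apply: eq_bigr => l _; rewrite !mxE.
Qed.

Lemma mxtrace_regroup m n p q (M : 'M[C]_((m * n) * (p * q))) : \tr (regroup M) = \tr M.
Proof.
by rewrite /mxtrace -[RHS]big_regroup; apply: eq_bigr => i _; rewrite mxE.
Qed.

Lemma regroupD m n p q (A B : 'M[C]_((m * n) * (p * q))) :
  regroup (A + B) = regroup A + regroup B.
Proof. by apply/matrixP => i j; rewrite !mxE. Qed.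

Lemma regroupZ m n p q c (A : 'M[C]_((m * n) * (p * q))) :
  regroup (c *: A) = c *: regroup A.
Proof. by apply/matrixP => i j; rewrite !mxE. Qed.

Lemma ptransE m n (A : 'M[C]_(m * n)) i j k l :
  ptrans A (idx (i, j)) (idx (k, l)) = A (idx (i, l)) (idx (k, j)).
Proof. by rewrite !mxE !mxtens_indexK. Qed.

Lemma ptransD m n (A B : 'M[C]_(m * n)) : ptrans (A + B) = ptrans A + ptrans B.
Proof. by apply/matrixP => i j; rewrite !mxE. Qed.

Lemma ptransZ m n c (A : 'M[C]_(m * n)) : ptrans (c *: A) = c *: ptrans A.
Proof. by apply/matrixP => i j; rewrite !mxE. Qed.

Lemma ptrans_adj m n (A : 'M[C]_(m * n)) : ptrans (adjmx A) = adjmx (ptrans A).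
Proof. by apply/matrixP => i j; rewrite !mxE. Qed.

Lemma ptrans_tens m n (A : 'M[C]_m) (B : 'M[C]_n) : ptrans (A *t B) = A *t B^T.
Proof. by apply/matrixP => i j; rewrite !mxE !mxtens_indexK. Qed.

Lemma ptransK m n (A : 'M[C]_(m * n)) : ptrans (ptrans A) = A.
Proof.
apply/matrixP => k l; case: (mxtens_indexP k) => i j; case: (mxtens_indexP l) => i' j'.
by rewrite !ptransE.
Qed.

Lemma ptrans_btens m n p q (A : 'M[C]_(m * n)) (B : 'M[C]_(p * q)) :
  ptrans (btens A B) = btens (ptrans A) (ptrans B).
Proof.
apply/matrixP => k l.
case: (mxtens_indexP k) => x y; case: (mxtens_indexP l) => x' y'.
case: (mxtens_indexP x) => i i'; case: (mxtens_indexP y) => j j'.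
case: (mxtens_indexP x') => u u'; case: (mxtens_indexP y') => v v'.
by rewrite ptransE /btens [LHS]mxE [RHS]mxE !regroup_indexE !tensmxE !ptransE.
Qed.

Lemma psd_btens m n p q (A : 'M[C]_(m * n)) (B : 'M[C]_(p * q)) :
  psd A -> psd B -> psd (btens A B).
Proof.
move=> /psd_factor[S ->] /psd_factor[T ->].
rewrite /btens -tensmx_mul -adjmx_tens regroup_mul_adj.
exact: psd_mul_adj.
Qed.

Lemma is_state_btens m n p q (A : 'M[C]_(m * n)) (B : 'M[C]_(p * q)) :
  is_state A -> is_state B -> is_state (btens A B).
Proof.
move=> [pA tA] [pB tB]; split; first exact: psd_btens.
by rewrite mxtrace_regroup mxtrace_tens tA tB mulr1.
Qed.

(** For an isometry [H] this bounds the overlap of products with the projector H H^dag. Allowing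
    several columns in [a] and [b] lets factors of mixed states be inserted directly, with no
    decomposition into pure states. *)
Definition sep_bounded m n k (H : 'M[C]_(m * n, k)) (c : R) : Prop :=
  forall r s (a : 'M[C]_(m, r)) (b : 'M[C]_(n, s)),
    sqnorm (adjmx H *m (a *t b)) <= c * (sqnorm a * sqnorm b).

(** By convexity it suffices to treat A (x) B. With A = S S^dag and B = T T^dag the overlap is the
    squared norm of H^dag (S (x) T), and trace one says that [S] and [T] have norm one. *)
Lemma sep_overlap_le m n k (H : 'M[C]_(m * n, k)) c (sigma : 'M[C]_(m * n)) :
  sep_bounded H c -> SEP sigma -> complex.Re (\tr (adjmx H *m sigma *m H)) <= c.
Proof.
move=> Hc [r [w [A [B [w0 w1 AB ->]]]]].
rewrite mulmx_sumr mulmx_suml (raddf_sum (@mxtrace C k)) raddf_sum /=.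
rewrite -[leRHS]mul1r -w1 mulr_suml; apply: ler_sum => i _.
have [[/psd_factor[S ES] tA] [/psd_factor[T ET] tB]] := AB i.
have := Hc _ _ S T.
have -> : sqnorm S = 1 by apply: complexI; rewrite -mxtrace_mul_adj -ES.
have -> : sqnorm T = 1 by apply: complexI; rewrite -mxtrace_mul_adj -ET.
have -> : \tr (adjmx H *m ((w i)%:C *: (A i *t B i)) *m H) =
    (w i * sqnorm (adjmx H *m (S *t T)))%:C.
  rewrite rmorphM /= -mxtrace_mul_adj -scalemxAr -scalemxAl mxtraceZ.
  by rewrite ES ET -tensmx_mul -adjmx_tens adjmxM adjmxK !mulmxA.
by rewrite !mulr1 /= => ?; rewrite ler_wpM2l.
Qed.

Lemma is_state_delta n (i : 'I_n) : is_state (delta_mx i i : 'M[C]_n).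
Proof.
have -> : delta_mx i i = (delta_mx i i : 'M[C]_n) *m adjmx (delta_mx i i).
  by rewrite adjmx_delta mul_delta_mx.
split; first exact: psd_mul_adj.
rewrite adjmx_delta mul_delta_mx /mxtrace (bigD1 i) //= mxE !eqxx big1 ?addr0 //.
by move=> j /negPf ji; rewrite mxE ji.
Qed.

(** For every separable sigma, rho - sigma is Hermitian and traceless, so [trnorm_ge] applies with
    the same [H] throughout. *)
Lemma distSEP_ge m n k (rho : 'M[C]_(m * n)) (H : 'M[C]_(m * n, k)) c :
  is_state rho -> adjmx H *m H = 1%:M -> sep_bounded H c ->
  2 * (complex.Re (\tr (adjmx H *m rho *m H)) - c) <= distSEP rho.
Proof.
move=> [prho trho] HH Hc; apply: lb_le_inf.
  (* A lower bound passes to [inf] only for a nonempty set. A product basis state supplies an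
     element; indices exist because an empty matrix has trace 0, not 1. *)
  have [x [y _]] : exists (x : 'I_m) (y : 'I_n), True.
    case: (pickP 'I_(m * n)) => [i _|none].
      by case: (mxtens_indexP i) => x y; exists x, y.
    move: trho; rewrite /mxtrace big1 => [/eqP|i]; last by have := none i.
    by rewrite eq_sym oner_eq0.
  exists (trnorm (rho - delta_mx x x *t delta_mx y y)).
  exists (delta_mx x x *t delta_mx y y) => //.
  exists 1%N, (fun=> 1), (fun=> delta_mx x x), (fun=> delta_mx y y).
  split=> //; rewrite ?big_ord1 ?scale1r //.
  by move=> _; split; exact: is_state_delta.
move=> _ [sigma sep <-].
have [hs ts] : adjmx sigma = sigma /\ \tr sigma = 1.
  case: sep => [r [w [A [B [w0 w1 AB ->]]]]]; split.
    rewrite /adjmx !raddf_sum /=; apply: eq_bigr => i _.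
    have [[[hA _] _] [[hB _] _]] := AB i.
    by rewrite -[LHS]/(adjmx _) adjmxZr adjmx_tens hA hB.
  rewrite (raddf_sum (@mxtrace C (m * n))) /= -[RHS](rmorph1 (real_complex R)) -w1 rmorph_sum.
  apply: eq_bigr => i _; have [[_ tA] [_ tB]] := AB i.
  by rewrite mxtraceZ mxtrace_tens tA tB !mulr1.
apply: le_trans (trnorm_ge _ _ HH); last 2 first.
- by rewrite adjmxD adjmxN hs prho.1.
- by rewrite raddfB /= trho ts subrr.
rewrite mulmxBr mulmxBl (raddfB (@mxtrace C k)) raddfB /= ler_pM2l // lerD2l lerN2.
exact: sep_overlap_le.
Qed.

End TensorProducts.

(** * How the separable overlap shrinks when one more pair is added *)

Section SeparableOverlap.
Context {R : realType}.
Local Notation C := R[i].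
Local Notation idx := mxtens_index.

(** Partial inner product with the basis vector |x> of the second factor. *)
Definition slice m p r (A : 'M[C]_(m * p, r)) (x : 'I_p) : 'M[C]_(m, r) :=
  rowsub (fun i => idx (i, x)) A.

Lemma sqnorm_slice m p r (A : 'M[C]_(m * p, r)) : sqnorm A = \sum_x sqnorm (slice A x).
Proof.
rewrite /sqnorm big_mxtens exchange_big; apply: eq_bigr => x _.
by apply: eq_bigr => i _; apply: eq_bigr => j _; rewrite mxE.
Qed.

Lemma sqnorm_tens m n p q (A : 'M[C]_(m, n)) (B : 'M[C]_(p, q)) :
  sqnorm (A *t B) = sqnorm A * sqnorm B.
Proof.
by apply: complexI; rewrite -mxtrace_adj_mul adjmx_tens tensmx_mul mxtrace_tens
  !mxtrace_adj_mul rmorphM.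
Qed.

(** Expanding the second pair in its product basis |x>|y> conditions [a] and [b] on [x] and [y]
    separately, so only product terms reach [H]. *)
Lemma slice_regroup_tens m n p q k g r s (H : 'M[C]_(m * n, k)) (G : 'M[C]_(p * q, g))
    (a : 'M[C]_(m * p, r)) (b : 'M[C]_(n * q, s)) z :
  slice (adjmx (regroup_rows (H *t G)) *m (a *t b)) z =
  \sum_x \sum_y conjc (G (idx (x, y)) z) *: (adjmx H *m (slice a x *t slice b y)).
Proof.
apply/matrixP => h l; case: (mxtens_indexP l) => u v.
rewrite mxE mxE big_mxtens big_mxtens summxE exchange_big; apply: eq_bigr => x _.
rewrite summxE.
under [RHS]eq_bigr => y _ do rewrite mxE mxE big_mxtens mulr_sumr.
rewrite [RHS]exchange_big; apply: eq_bigr => i _.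
rewrite big_mxtens exchange_big; apply: eq_bigr => y _.
rewrite mulr_sumr; apply: eq_bigr => j _.
rewrite adjmxE [regroup_rows _ _ _]mxE regroup_indexE !tensmxE adjmxE !mxE rmorphM /=.
by rewrite -!mulrA mulrCA.
Qed.

Lemma sum_pair_delta (V : lmodType C) (I J : finType) (F : I -> J -> V) x0 y0 (c : C) :
  \sum_x \sum_y (((x == x0) && (y == y0))%:R * c) *: F x y = c *: F x0 y0.
Proof.
rewrite (bigD1 x0) //= (bigD1 y0) //= !eqxx mul1r.
rewrite big1 ?addr0 => [|y /negPf ->]; last by rewrite mul0r scale0r.
rewrite big1 ?addr0 // => x /negPf ->.
by rewrite big1 // => y _; rewrite mul0r scale0r.
Qed.

(* Use t = (x1 + d) / (x0 + d) and let d tend to 0; the shift d covers x0 x1 = 0. *)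
Lemma le_weighted_mul (S K x0 x1 y0 y1 : R) : 0 <= K ->
  0 <= x0 -> 0 <= x1 -> 0 <= y0 -> 0 <= y1 ->
  (forall t, 0 < t -> S <= K * ((1 + t) * (x0 * y0) + (1 + t^-1) * (x1 * y1))) ->
  S <= K * ((x0 + x1) * (y0 + y1)).
Proof.
move=> K0 x00 x10 y00 y10 H; apply/ler_addgt0Pr => e e0.
have Q0 : 0 < K * (y0 + y1) + 1 by rewrite ltr_wpDl // mulr_ge0 // addr_ge0.
pose d := e / (K * (y0 + y1) + 1).
have d0 : 0 < d by rewrite divr_gt0.
have X0 : 0 < x0 + d by rewrite ltr_wpDl.
have X1 : 0 < x1 + d by rewrite ltr_wpDl.
apply: le_trans (H ((x1 + d) / (x0 + d)) _) _; first by rewrite divr_gt0.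
have h u v y : 0 <= u -> 0 <= v -> 0 <= y -> v / (u + d) * (u * y) <= v * y.
  move=> u0 v0 y0'; rewrite mulrA ler_wpM2r // -mulrA ler_piMr //.
  by rewrite mulrC ler_pdivrMr ?ltr_wpDl // mul1r lerDl ltW.
have h0 := h x0 (x1 + d) y0 x00 (ltW X1) y00.
have h1 := h x1 (x0 + d) y1 x10 (ltW X0) y10.
have Ed : K * (y0 + y1) * d <= e.
  rewrite /d mulrCA ler_piMr ?(ltW e0) //.
  by rewrite ler_pdivrMr // mul1r lerDl.
rewrite invf_div.
apply: (@le_trans _ _ (K * ((x0 + x1) * (y0 + y1)) + K * (y0 + y1) * d)); last first.
  by rewrite lerD2l.
have -> : K * ((x0 + x1) * (y0 + y1)) + K * (y0 + y1) * d =
  K * (x0 * y0 + (x1 + d) * y0 + (x1 * y1 + (x0 + d) * y1)) by ring.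
rewrite ler_wpM2l // 2![(1 + _) * _]mulrDl !mul1r.
by rewrite lerD // lerD.
Qed.

(** Column (i, j) of [G] couples the products 0i|0j and 1j|1i. The weighted inequality bounds its
    contribution by those of the two products, and each of these bounds, summed over i and j,
    factorizes: x0 y0 and x1 y1, where x0 + x1 and y0 + y1 are the squared norms of [a] and [b].
    Choosing the weight gives (x0 + x1)(y0 + y1), so the bound only picks up the factor s^2. *)
Lemma sep_bounded_twist m n k ds (H : 'M[C]_(m * n, k)) (c s : R)
    (G : 'M[C]_((2 * ds) * (2 * ds), 1 * (ds * ds))) (w : 'I_ds -> 'I_ds -> C) :
  0 <= c -> sep_bounded H c -> (forall i j, sqmod (w i j) = 1) ->
  (forall x y i j, G (idx (x, y)) (idx (0, idx (i, j))) =
     ((x == idx (0, i)) && (y == idx (0, j)))%:R * s%:C +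
     ((x == idx (1, j)) && (y == idx (1, i)))%:R * (s%:C * conjc (w i j))) ->
  sep_bounded (regroup_rows (H *t G)) (s ^+ 2 * c).
Proof.
move=> c0 Hc w1 GE r u a b.
pose A x := sqnorm (slice a x); pose B y := sqnorm (slice b y).
pose T x y := adjmx H *m (slice a x *t slice b y).
have A0 x : 0 <= A x by exact: sqnorm_ge0.
have B0 y : 0 <= B y by exact: sqnorm_ge0.
have sliceE i j : slice (adjmx (regroup_rows (H *t G)) *m (a *t b)) (idx (0, idx (i, j))) =
    s%:C *: (T (idx (0, i)) (idx (0, j)) + w i j *: T (idx (1, j)) (idx (1, i))).
  have conjE (b1 b2 : bool) (z : C) :
      conjc (b1%:R * s%:C + b2%:R * (s%:C * conjc z)) = b1%:R * s%:C + b2%:R * (s%:C * z).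
    by case: b1 b2 z => [] [] [? ?]; apply/eqP; rewrite eq_complex /=; apply/andP;
      split; apply/eqP; ring.
  rewrite slice_regroup_tens.
  under eq_bigr => x _ do under eq_bigr => y _ do rewrite GE conjE scalerDl.
  under eq_bigr => x _ do rewrite big_split /=.
  rewrite big_split /= !sum_pair_delta scalerDr scalerA.
  by [].
have sumE : sqnorm (adjmx (regroup_rows (H *t G)) *m (a *t b)) = s ^+ 2 *
    \sum_i \sum_j sqnorm (T (idx (0, i)) (idx (0, j)) + w i j *: T (idx (1, j)) (idx (1, i))).
  rewrite sqnorm_slice big_mxtens big_ord1 big_mxtens mulr_sumr; apply: eq_bigr => i _.
  rewrite mulr_sumr; apply: eq_bigr => j _.
  by rewrite sliceE sqnormZ sqmod_real.
rewrite sumE -mulrA ler_wpM2l ?sqr_ge0 // !sqnorm_slice !big_mxtens.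
rewrite big_ord_recl big_ord1 [\sum_(_ < 2) _]big_ord_recl big_ord1.
apply: le_weighted_mul => //; try by apply: sumr_ge0 => i _; exact: sqnorm_ge0.
move=> t t0.
have TB x y : sqnorm (T x y) <= c * (A x * B y) by exact: Hc.
apply: (@le_trans _ _ (\sum_i \sum_j (c * ((1 + t) * (A (idx (0, i)) * B (idx (0, j))) +
    (1 + t^-1) * (A (idx (1, j)) * B (idx (1, i))))))).
  apply: ler_sum => i _; apply: ler_sum => j _.
  apply: le_trans (sqnormD _ _ t0) _.
  rewrite sqnormZ w1 mul1r mulrDr (mulrCA c (1 + t)) (mulrCA c (1 + t^-1)).
  by rewrite lerD // ler_wpM2l // ?addr_ge0 ?invr_ge0 ?ler01 ?(ltW t0).
have prodE (f g : 'I_ds -> R) : (\sum_i f i) * (\sum_j g j) = \sum_i \sum_j f i * g j.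
  by rewrite mulr_suml; apply: eq_bigr => i _; rewrite mulr_sumr.
have -> : lift ord0 ord0 = 1 :> 'I_2 by apply: val_inj.
(* In the second product the indices are crossed, [A] at 1j with [B] at 1i, hence the exchange of
   sums before comparing terms. *)
rewrite -[ord0]/(0 : 'I_2) !prodE [X in _ + _ * X]exchange_big /= 2!mulr_sumr -big_split mulr_sumr.
apply: ler_sum => i _; rewrite 2!mulr_sumr -big_split mulr_sumr.
by apply: ler_sum => j _.
Qed.

End SeparableOverlap.

(** * Two-by-two blocks built from partial isometries *)

Section BlockState.
Context {R : realType}.
Local Notation C := R[i].
Local Notation idx := mxtens_index.

Lemma psdD n (A B : 'M[C]_n) : psd A -> psd B -> psd (A + B).
Proof.
move=> [hA A0] [hB B0]; split; first by rewrite adjmxD hA hB.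
by move=> v; rewrite mulmxDr mulmxDl mxE addr_ge0 // (A0, B0).
Qed.

Lemma psdZ n (c : R) (A : 'M[C]_n) : 0 <= c -> psd A -> psd (c%:C *: A).
Proof.
move=> c0 [hA A0]; split; first by rewrite adjmxZr hA.
by move=> v; rewrite -scalemxAr -scalemxAl mxE mulr_ge0 // ler0c.
Qed.

Lemma psd_regroup m n p q (A : 'M[C]_((m * n) * (p * q))) : psd A -> psd (regroup A).
Proof. by move=> /psd_factor[S ->]; rewrite regroup_mul_adj; exact: psd_mul_adj. Qed.

Lemma delta_tens m n p q (i : 'I_m) (j : 'I_n) (k : 'I_p) (l : 'I_q) :
  delta_mx (idx (i, j)) (idx (k, l)) = delta_mx i k *t delta_mx j l :> 'M[C]__.
Proof.
apply/matrixP => x y; case: (mxtens_indexP x) => a b; case: (mxtens_indexP y) => c e.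
by rewrite tensmxE !mxE !mxtens_index_eq !xpair_eqE -natrM mulnb andbACA.
Qed.

Lemma ptrans_delta m n (i k : 'I_m) (j l : 'I_n) :
  ptrans (delta_mx (idx (i, j)) (idx (k, l)) : 'M[C]__) = delta_mx (idx (i, l)) (idx (k, j)).
Proof. by rewrite !delta_tens ptrans_tens trmx_delta. Qed.

Definition partial_isometry n (Z : 'M[C]_n) : Prop := Z *m adjmx Z *m Z = Z.

Lemma partial_isometry_adj n (Z : 'M[C]_n) :
  partial_isometry Z -> partial_isometry (adjmx Z).
Proof. by move=> ZP; rewrite /partial_isometry -{4}ZP !adjmxM adjmxK !mulmxA. Qed.

(** Z Z^dag is a projector, hence its own square root. *)
Lemma sqrtm_partial_isometry n (c : R) (Z : 'M[C]_n) : 0 <= c -> partial_isometry Z ->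
  sqrtm ((c%:C *: Z) *m adjmx (c%:C *: Z)) = c%:C *: (Z *m adjmx Z).
Proof.
move=> c0 ZP; apply: sqrtm_eq; first by apply: psdZ => //; exact: psd_mul_adj.
rewrite adjmxZr -!scalemxAl -!scalemxAr !scalerA; congr (_ *: _).
by rewrite mulmxA ZP.
Qed.

Lemma sqrtm_partial_isometry_adj n (c : R) (Z : 'M[C]_n) : 0 <= c -> partial_isometry Z ->
  sqrtm (adjmx (c%:C *: Z) *m (c%:C *: Z)) = c%:C *: (adjmx Z *m Z).
Proof.
move=> c0 /partial_isometry_adj ZP.
by have := sqrtm_partial_isometry c0 ZP; rewrite adjmxZr adjmxK adjmxZr.
Qed.

Section Block.
Context {q n : nat}.
Implicit Types (u v : 'I_q) (Z : 'M[C]_n).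

(** The common shape of both blocks of rho, up to a scalar, once the square roots are replaced by
    projectors. *)
Definition block u v Z : 'M[C]_(q * n) :=
  delta_mx u u *t (Z *m adjmx Z) + delta_mx u v *t Z +
  delta_mx v u *t adjmx Z + delta_mx v v *t (adjmx Z *m Z).

(** A square-root factor of [block u v Z]; for unitary [Z] its columns are orthogonal of squared
    norm 2. *)
Definition block_factor u v Z : 'M[C]_(q * n, 1 * n) :=
  delta_mx u 0 *t (Z *m adjmx Z) + delta_mx v 0 *t adjmx Z.

Lemma block_scale u v (c : R) Z :
  delta_mx u u *t (c%:C *: (Z *m adjmx Z)) + delta_mx u v *t (c%:C *: Z) +
  delta_mx v u *t adjmx (c%:C *: Z) + delta_mx v v *t (c%:C *: (adjmx Z *m Z)) =
  c%:C *: block u v Z.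
Proof. by rewrite adjmxZr !tensmxZr -!scalerDr. Qed.

Lemma adj_block_factor u v Z : adjmx (block_factor u v Z) =
  delta_mx 0 u *t (Z *m adjmx Z) + delta_mx 0 v *t Z.
Proof. by rewrite adjmxD !adjmx_tens !adjmx_delta adjmxM !adjmxK. Qed.

Lemma blockE u v Z : partial_isometry Z ->
  block u v Z = block_factor u v Z *m adjmx (block_factor u v Z).
Proof.
move=> ZP; have ZP' : adjmx Z *m (Z *m adjmx Z) = adjmx Z.
  by have := partial_isometry_adj ZP; rewrite /partial_isometry adjmxK mulmxA.
rewrite adj_block_factor mulmxDl !mulmxDr !tensmx_mul !mul_delta_mx.
by rewrite mulmxA ZP ZP' !addrA.
Qed.

Lemma block_factor_adj_mul u v Z : u != v -> partial_isometry Z ->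
  adjmx (block_factor u v Z) *m block_factor u v Z =
  2%:R *: (delta_mx 0 0 *t (Z *m adjmx Z)).
Proof.
move=> uv ZP.
rewrite adj_block_factor mulmxDl !mulmxDr !tensmx_mul !mul_delta_mx.
rewrite !mul_delta_mx_0 //; last by rewrite eq_sym.
rewrite !tens0mx addr0 add0r mulmxA ZP.
by rewrite scaler_nat mulr2n.
Qed.

Lemma block_factor_unitary u v Z : u != v -> Z *m adjmx Z = 1%:M ->
  adjmx (block_factor u v Z) *m block_factor u v Z = 2%:R%:M.
Proof.
move=> uv ZZ; rewrite block_factor_adj_mul //; last by rewrite /partial_isometry ZZ mul1mx.
have -> : delta_mx 0 0 = 1%:M :> 'M[C]_1.
  by apply/matrixP => i j; rewrite !mxE !ord1 eqxx.
by rewrite ZZ tensmx1 scalemx1.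
Qed.

Lemma block_factor_orth u v u' v' Z Z' : u != u' -> u != v' -> v != u' -> v != v' ->
  adjmx (block_factor u v Z) *m block_factor u' v' Z' = 0.
Proof.
move=> *; rewrite adj_block_factor mulmxDl !mulmxDr !tensmx_mul.
by rewrite !mul_delta_mx_0 // !tens0mx !addr0.
Qed.

Lemma mxtrace_block u v Z : u != v -> partial_isometry Z ->
  \tr (block u v Z) = 2%:R * \tr (Z *m adjmx Z).
Proof.
move=> uv ZP; rewrite blockE // mxtrace_mulC block_factor_adj_mul //.
by rewrite mxtraceZ mxtrace_tens /mxtrace big_ord1 mxE !eqxx mul1r.
Qed.

End Block.

Lemma scale_half_comb n (a b x y : R) (A B : 'M[C]_n) :
  (2^-1)%:C *: (a%:C *: (x%:C *: A) + b%:C *: (y%:C *: B)) =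
  (2^-1 * a * x)%:C *: A + (2^-1 * b * y)%:C *: B.
Proof. by rewrite scalerDr !scalerA !(rmorphM (real_complex R)). Qed.

(** Gathers the off-diagonal terms of both blocks of rho under one coefficient. The hypothesis
    [c * s = d] is where the value of [p] will enter. *)
Lemma block_comb (V : lmodType C) (c s d : C) (A B B' D E F F' H : V) : c * s = d ->
  c *: (A + s *: B + s *: B' + D) + d *: (E + F + F' + H) =
  c *: (A + D) + d *: (B + B' + (F + F')) + d *: (E + H).
Proof.
by move=> <-; rewrite !scalerDr !scalerA (AC (4*4) ((1*4)*((2*3)*(6*7))*(5*8))).
Qed.

Lemma indicator_conj (z w u : C) (b1 b2 b3 b4 : bool) :
  z * ((b1 && b2)%:R * conjc (w * (u * (b3 && b4)%:R))) =
  ((b1 && b3) && (b2 && b4))%:R * (z * conjc (w * u)).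
Proof.
rewrite andbACA -[in RHS]mulnb natrM (mulrA w) [conjc (_ * _%:R)]rmorphM /= conjc_nat.
by move: (conjc _) (_%:R) (_%:R) => k x y; ring.
Qed.

Lemma linear_comb8 (V V' : lmodType C) (f : V -> V') (c d e : C)
    (A D B B' F F' E H : V) :
  (forall x y, f (x + y) = f x + f y) -> (forall a x, f (a *: x) = a *: f x) ->
  f (c *: (A + D) + d *: (B + B' + (F + F')) + e *: (E + H)) =
  c *: (f A + f D) + d *: (f B + f B' + (f F + f F')) + e *: (f E + f H).
Proof. by move=> fD fZ; rewrite !fD !fZ !fD. Qed.

(** The part orthogonal to [G] drops out, and G^dag G G^dag G is 4 times the identity of size
    [k]. *)
Lemma mxtrace_compress m k k' (G : 'M[C]_(m, k)) (G' : 'M[C]_(m, k')) (s c d : R) :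
  adjmx G *m G = 2%:R%:M -> adjmx G *m G' = 0 ->
  \tr (adjmx (s%:C *: G) *m
    (c%:C *: (G *m adjmx G) + d%:C *: (G' *m adjmx G')) *m (s%:C *: G)) =
  (s ^+ 2 * c * (4 * k%:R))%:C.
Proof.
move=> GG GG'; rewrite adjmxZr -!scalemxAl -scalemxAr mulmxDr mulmxDl.
rewrite -!scalemxAr -!scalemxAl !mulmxA GG GG' !mul0mx scaler0 addr0.
rewrite mul_scalar_mx -scalemxAl GG !mxtraceZ mxtrace_scalar.
by rewrite -mulr_natr !rmorphM /= !rmorph_nat; ring.
Qed.

Lemma ptrans_regroup_tens m (a b c e : 'I_2) (M : 'M[C]_(m * m)) :
  ptrans (regroup (delta_mx (idx (a, b)) (idx (c, e)) *t M)) =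
  regroup (delta_mx (idx (a, e)) (idx (c, b)) *t ptrans M).
Proof.
rewrite -[LHS]/(ptrans (btens (delta_mx (idx (a, b)) (idx (c, e))) M)).
by rewrite ptrans_btens ptrans_delta.
Qed.

(** Transposing B turns |00><11| into |01><10|, and transposing B' turns [S] into [T]: the outer and
    inner off-diagonal terms trade places, while the diagonal ones are fixed. *)
Lemma ptrans_crossed_blocks m (c d e : C) (Q S T P : 'M[C]_(m * m)) :
  ptrans Q = Q -> ptrans P = P -> ptrans S = T ->
  let D x y u v : 'M[C]_(2 * 2) := delta_mx (idx (x, y)) (idx (u, v)) in
  let M := c *: (D 0 0 0 0 *t Q + D 1 1 1 1 *t Q) +
    d *: (D 0 0 1 1 *t S + D 1 1 0 0 *t adjmx S + (D 0 1 1 0 *t T + D 1 0 0 1 *t adjmx T)) +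
    e *: (D 0 1 0 1 *t P + D 1 0 1 0 *t P) in
  ptrans (regroup M) = regroup M.
Proof.
move=> Qt Pt St D M.
have Tt : ptrans T = S by rewrite -St ptransK.
rewrite /M (linear_comb8 (f := @regroup R 2 2 m m)); last 2 first.
- exact: regroupD.
- exact: regroupZ.
rewrite (linear_comb8 (f := @ptrans R (2 * m) (2 * m))); last 2 first.
- exact: ptransD.
- exact: ptransZ.
rewrite /D !ptrans_regroup_tens !ptrans_adj Qt Pt St Tt.
by rewrite (addrC (regroup (delta_mx (idx (0, 1)) (idx (1, 0)) *t T) + _)).
Qed.

End BlockState.

(** * The state rho of a flat unitary: invariance and overlap *)

Section FlatUnitary.
Context {R : realType} {ds : nat} (U : 'M[R[i]]_ds).
Hypothesis ds_gt0 : (0 < ds)%N.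
Hypothesis flatU : flat_unitary U.
Local Notation C := R[i].
Local Notation idx := mxtens_index.
Local Notation rtds := (Num.sqrt (ds%:R : R)).
Local Notation p := (pparam R ds).

Definition twisted_swap : 'M[C]_(ds * ds) := \sum_i \sum_j U i j *: kb2 R i j j i.
Definition diag_lift : 'M[C]_(ds * ds) := \sum_i \sum_j U i j *: kb2 R i i j j.
(** The scaling turns the entries of [U] into phases, so this is a swap with phases, a unitary
    multiple of [Xop U]. *)
Definition swap_phase : 'M[C]_(ds * ds) := rtds%:C *: twisted_swap.
(** The isometry |c> -> |cc>, which carries [U] to [diag_lift], the unnormalized [Yop U]. *)
Definition diag_embed : 'M[C]_(ds * ds, ds) := \matrix_(k, c) (k == idx (c, c))%:R.

Let dsR_gt0 : 0 < ds%:R :> R. Proof. by rewrite ltr0n. Qed.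
Let rtds_gt0 : 0 < rtds. Proof. by rewrite sqrtr_gt0. Qed.
Let rtds_sqr : rtds * rtds = ds%:R.
Proof. by rewrite -expr2 sqr_sqrtr // ltW. Qed.

Lemma twisted_swapE a b c e :
  twisted_swap (idx (a, b)) (idx (c, e)) = U a b * ((c == b) && (e == a))%:R.
Proof.
rewrite summxE (bigD1 a) //= [X in _ + X]big1 => [|i /negPf ia]; last first.
  rewrite summxE big1 // => j _.
  by rewrite !mxE mxtens_index_eq xpair_eqE eq_sym ia mulr0.
rewrite addr0 summxE (bigD1 b) //= [X in _ + X]big1 => [|j /negPf jb]; last first.
  by rewrite !mxE mxtens_index_eq xpair_eqE [b == j]eq_sym jb andbF mulr0.
by rewrite addr0 !mxE !mxtens_index_eq !xpair_eqE !eqxx.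
Qed.

Lemma sqmod_flat i j : sqmod (rtds%:C * U i j) = 1.
Proof.
have := flatU.2 i j; rewrite norm_sqmod => /complexI UE.
rewrite sqmodM sqmod_real -(sqr_sqrtr (sqmod_ge0 (U i j))) UE exprVn.
by rewrite mulfV // expf_neq0 // gt_eqF.
Qed.

Lemma swap_phase_unitary : swap_phase *m adjmx swap_phase = 1%:M.
Proof.
apply/matrixP => k l; case: (mxtens_indexP k) => a b; case: (mxtens_indexP l) => c e.
rewrite mxE big_mxtens (bigD1 b) //= [X in _ + X]big1 => [|i /negPf ia]; last first.
  by rewrite big1 // => j _; rewrite mxE twisted_swapE ia !mulr0 mul0r.
rewrite addr0 (bigD1 a) //= [X in _ + X]big1 => [|j /negPf jb]; last first.
  by rewrite mxE twisted_swapE jb andbF !mulr0 mul0r.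
rewrite addr0 adjmxE ![swap_phase _ _]mxE !twisted_swapE !eqxx /= mulr1 mxE.
rewrite mxtens_index_eq xpair_eqE.
have [<-|_] := eqVneq a c; last by rewrite andbF mulr0 mulr0 conjc0 mulr0.
have [<-|_] := eqVneq b e; last by rewrite mulr0 mulr0 conjc0 mulr0.
by rewrite mulr1 mulrC -sqmodE sqmod_flat.
Qed.

Lemma diag_embed_isometry : adjmx diag_embed *m diag_embed = 1%:M.
Proof.
apply/matrixP => c e; rewrite !mxE (bigD1 (idx (c, c))) //= big1 ?addr0 => [|k kc].
  by rewrite !mxE eqxx conjc_nat mul1r mxtens_index_eq xpair_eqE andbb.
by rewrite !mxE (negPf kc) conjc0 mul0r.
Qed.

Lemma diag_liftE : diag_lift = diag_embed *m U *m adjmx diag_embed.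
Proof.
apply/matrixP => k l; rewrite summxE mxE.
under eq_bigr do rewrite summxE.
rewrite exchange_big; apply: eq_bigr => j _.
rewrite mxE mulr_suml; apply: eq_bigr => i _.
by rewrite !mxE conjc_nat -mulnb natrM mulrCA !mulrA.
Qed.

Lemma diag_embed_mul_adj : diag_embed *m adjmx diag_embed = \sum_i kb2 R i i i i.
Proof.
apply/matrixP => k l; rewrite summxE mxE; apply: eq_bigr => i _.
by rewrite !mxE conjc_nat -natrM mulnb.
Qed.

Lemma diag_lift_mul_adj : diag_lift *m adjmx diag_lift = diag_embed *m adjmx diag_embed.
Proof.
rewrite diag_liftE !adjmxM adjmxK -!mulmxA (mulmxA (adjmx diag_embed) diag_embed).
by rewrite diag_embed_isometry mul1mx (mulmxA U) flatU.1 mul1mx.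
Qed.

Lemma diag_lift_adj_mul : adjmx diag_lift *m diag_lift = diag_embed *m adjmx diag_embed.
Proof.
rewrite diag_liftE !adjmxM adjmxK -!mulmxA (mulmxA (adjmx diag_embed) diag_embed).
by rewrite diag_embed_isometry mul1mx (mulmxA (adjmx U)) (mulmx1C flatU.1) mul1mx.
Qed.

Lemma diag_lift_partial_isometry : partial_isometry diag_lift.
Proof.
rewrite /partial_isometry diag_lift_mul_adj diag_liftE -!mulmxA.
by rewrite (mulmxA (adjmx diag_embed)) diag_embed_isometry mul1mx.
Qed.

Lemma swap_phase_partial_isometry : partial_isometry swap_phase.
Proof. by rewrite /partial_isometry swap_phase_unitary mul1mx. Qed.

Lemma ptrans_kb2 (i j k l : 'I_ds) : ptrans (kb2 R i j k l) = kb2 R i l k j.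
Proof. exact: ptrans_delta. Qed.

Lemma ptrans_sum_kb2 (f : 'I_ds -> 'I_ds -> 'I_ds * 'I_ds * ('I_ds * 'I_ds)) :
  ptrans (\sum_i \sum_j U i j *: kb2 R (f i j).1.1 (f i j).1.2 (f i j).2.1 (f i j).2.2) =
  \sum_i \sum_j U i j *: kb2 R (f i j).1.1 (f i j).2.2 (f i j).2.1 (f i j).1.2.
Proof.
apply/matrixP => k l; rewrite mxE !summxE; apply: eq_bigr => i _.
rewrite !summxE; apply: eq_bigr => j _.
have /matrixP/(_ k l) E := ptrans_kb2 (f i j).1.1 (f i j).1.2 (f i j).2.1 (f i j).2.2.
by rewrite [LHS]mxE [RHS]mxE -E [in RHS]mxE.
Qed.

Lemma ptrans_twisted_swap : ptrans twisted_swap = diag_lift.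
Proof. exact: (ptrans_sum_kb2 (fun i j => ((i, j), (j, i)))). Qed.

Lemma ptrans_diag_embed :
  ptrans (diag_embed *m adjmx diag_embed) = diag_embed *m adjmx diag_embed.
Proof.
rewrite diag_embed_mul_adj; apply/matrixP => k l; rewrite mxE !summxE.
by apply: eq_bigr => i _; have /matrixP/(_ k l) E := ptrans_kb2 i i i i; rewrite -[RHS]E [RHS]mxE.
Qed.

Lemma pparam_ge0 : 0 <= p.
Proof. by rewrite /pparam invr_ge0 addr_ge0 ?ler01 ?sqrtr_ge0. Qed.

Lemma subr_pparam : 1 - p = rtds * p.
Proof. by rewrite /pparam; field; rewrite gt_eqF // ltr_wpDl. Qed.

(** X and Y are the multiples ds^-2 and ds^-1 of partial isometries, which makes all four square
    roots explicit. *)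
Lemma rho_ABABE : rho_ABAB U =
  ((1 - p) / (2 * ds%:R ^+ 2))%:C *: block (idx (0, 0)) (idx (1, 1)) swap_phase +
  (p / (2 * ds%:R))%:C *: block (idx (0, 1)) (idx (1, 0)) diag_lift.
Proof.
have XE : Xop U = (ds%:R ^- 2)%:C *: swap_phase.
  rewrite /Xop /swap_phase scalerA -rmorphM /=; congr (_%:C *: _).
  by move: rtds_sqr rtds_gt0; move: (Num.sqrt _) => r <- r0; field; rewrite gt_eqF.
have YE : Yop U = (ds%:R^-1)%:C *: diag_lift by [].
have x0 : 0 <= ds%:R ^- 2 :> R by rewrite invr_ge0 exprn_ge0 // ltW.
have y0 : 0 <= ds%:R^-1 :> R by rewrite invr_ge0 ltW.
have SP := swap_phase_partial_isometry; have DP := diag_lift_partial_isometry.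
rewrite /rho_ABAB XE YE.
rewrite (sqrtm_partial_isometry x0 SP) (sqrtm_partial_isometry_adj x0 SP).
rewrite (sqrtm_partial_isometry y0 DP) (sqrtm_partial_isometry_adj y0 DP).
rewrite /kbAB (block_scale _ _ _ swap_phase) (block_scale _ _ _ diag_lift).
rewrite scale_half_comb.
by congr (_%:C *: _ + _%:C *: _); field; rewrite gt_eqF.
Qed.

Let dist_AB : [/\ idx (0, 0) != idx (1, 1) :> 'I_(2 * 2), idx (0, 1) != idx (1, 0) :> 'I_(2 * 2),
  idx (0, 0) != idx (0, 1) :> 'I_(2 * 2), idx (0, 0) != idx (1, 0) :> 'I_(2 * 2) &
  idx (1, 1) != idx (0, 1) :> 'I_(2 * 2) /\ idx (1, 1) != idx (1, 0) :> 'I_(2 * 2)].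
Proof. by rewrite !mxtens_index_eq. Qed.

(** Both blocks are psd by [blockE]. Their unscaled traces are 2 ds^2 and 2 ds, so they contribute 1
    - p and p. *)
Lemma is_state_rho : is_state (rho_state U).
Proof.
have SP := swap_phase_partial_isometry; have DP := diag_lift_partial_isometry.
have [uv uv' _ _ _] := dist_AB.
split.
  have q0 : 0 <= 1 - p by rewrite subr_pparam mulr_ge0 // ?pparam_ge0 // ltW.
  apply: psd_regroup; rewrite rho_ABABE (blockE _ _ SP) (blockE _ _ DP).
  by apply: psdD; apply: psdZ; (try exact: psd_mul_adj);
    rewrite divr_ge0 // ?pparam_ge0 // mulr_ge0 // ?exprn_ge0 // ltW.
rewrite mxtrace_regroup rho_ABABE mxtraceD 2!mxtraceZ (mxtrace_block uv SP) (mxtrace_block uv' DP).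
rewrite swap_phase_unitary diag_lift_mul_adj mxtrace_mulC diag_embed_isometry !mxtrace1.
rewrite -!(rmorph_nat (real_complex R)) -!rmorphM -rmorphD -(rmorph1 (real_complex R)).
by congr (_%:C); rewrite /= natrM; field; rewrite gt_eqF.
Qed.

Lemma ptrans_rho : ptrans (rho_state U) = rho_state U.
Proof.
have pt1 : ptrans (1%:M : 'M[C]_(ds * ds)) = 1%:M by rewrite -tensmx1 ptrans_tens trmx1.
(* The choice of [p]: it gives [twisted_swap] and its partial transpose [diag_lift] the same
   coefficient in rho. *)
have cE : (1 - p) / (2 * ds%:R ^+ 2) * rtds = p / (2 * ds%:R).
  rewrite subr_pparam; move: rtds_sqr rtds_gt0; move: (Num.sqrt _) (p) => r p <- r0.
  by field; rewrite gt_eqF.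
rewrite /rho_state rho_ABABE /block.
rewrite (mulmx1C swap_phase_unitary) swap_phase_unitary diag_lift_mul_adj diag_lift_adj_mul.
rewrite (adjmxZr _ twisted_swap) 2!tensmxZr
  (block_comb _ _ _ _ _ _ _ _ (d := (p / (2 * ds%:R))%:C)); last first.
  by rewrite -(rmorphM (real_complex R)) cE.
exact: ptrans_crossed_blocks pt1 ptrans_diag_embed ptrans_twisted_swap.
Qed.

(** Its columns form an orthonormal basis of the support of the |00>, |11> block, in the AA'|BB'
    order. *)
Definition pbit_isometry : 'M[C]_((2 * ds) * (2 * ds), 1 * (ds * ds)) :=
  regroup_rows ((Num.sqrt 2)^-1%:C *: block_factor (idx (0, 0)) (idx (1, 1)) swap_phase).

Let sqrt2 : (Num.sqrt 2)^-1 * (Num.sqrt 2)^-1 = 2^-1 :> R.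
Proof. by rewrite -invfM -expr2 sqr_sqrtr. Qed.

Lemma pbit_isometryP : adjmx pbit_isometry *m pbit_isometry = 1%:M.
Proof.
have [uv _ _ _ _] := dist_AB.
rewrite regroup_adj_mul adjmxZr -scalemxAl -scalemxAr scalerA -rmorphM /= sqrt2.
rewrite (block_factor_unitary uv swap_phase_unitary) scale_scalar_mx.
by rewrite -(rmorph_nat (real_complex R)) -rmorphM /= mulVf ?rmorph1.
Qed.

Lemma pbit_overlap :
  \tr (adjmx pbit_isometry *m rho_state U *m pbit_isometry) = (1 - p)%:C.
Proof.
have [uv _ d1 d2 [d3 d4]] := dist_AB.
rewrite -mulmxA /rho_state regroup_mul_rows regroup_adj_mul mulmxA rho_ABABE.
rewrite (blockE _ _ swap_phase_partial_isometry) (blockE _ _ diag_lift_partial_isometry).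
rewrite mxtrace_compress; last 2 first.
- exact: block_factor_unitary swap_phase_unitary.
- exact: block_factor_orth.
congr (_%:C); rewrite expr2 sqrt2 mul1n natrM.
by field; rewrite gt_eqF.
Qed.

(** The entries in the form required by [sep_bounded_twist], with s = 1/sqrt 2 and w_ij = sqrt ds
    u_ij. *)
Lemma pbit_isometryE x y i j : pbit_isometry (idx (x, y)) (idx (0, idx (i, j))) =
  ((x == idx (0, i)) && (y == idx (0, j)))%:R * (Num.sqrt 2)^-1%:C +
  ((x == idx (1, j)) && (y == idx (1, i)))%:R *
    ((Num.sqrt 2)^-1%:C * conjc (rtds%:C * U i j)).
Proof.
case: (mxtens_indexP x) => s i'; case: (mxtens_indexP y) => t j'.
rewrite mxE regroup_indexE mxE mxE !tensmxE swap_phase_unitary adjmxE.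
rewrite [swap_phase _ _]mxE twisted_swapE !mxE !mxtens_index_eq !xpair_eqE !andbT.
by rewrite mulrDr indicator_conj -natrM mulnb andbACA [X in X + _]mulrC.
Qed.

End FlatUnitary.

(** * Induction on the number of tensor factors *)

Section TensorPowers.
Context {R : realType}.
Local Notation C := R[i].

(* The observable telling rho apart from the separable states is 2 H H^dag - 1. *)
Definition has_witness m (rho : 'M[C]_(m * m)) (q c : R) : Prop :=
  [/\ is_state rho, ptrans rho = rho &
      exists k (H : 'M[C]_(m * m, k)),
        [/\ adjmx H *m H = 1%:M, \tr (adjmx H *m rho *m H) = q%:C & sep_bounded H c]].

(** [tpow] casts along n ^ k * n = n ^ k.+1; case analysis on the equality removes the cast. *)
Lemma has_witness_cast m m' (e : m = m') (rho : 'M[C]_(m * m)) q c :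
  has_witness rho q c ->
  has_witness (castmx (congr2 muln e e, congr2 muln e e) rho) q c.
Proof. by case: m' / e; rewrite castmx_id. Qed.

Lemma has_witness1 : has_witness (1%:M : 'M[C]_(1 * 1)) 1 1.
Proof.
split.
- split; first by rewrite -[1%:M]mulmx1 -{2}adjmx1; exact: psd_mul_adj.
  by rewrite mxtrace1.
- by rewrite -[X in ptrans X]tensmx1 ptrans_tens trmx1 tensmx1.
exists (1 * 1)%N, 1%:M; rewrite adjmx1 !mulmx1 mxtrace1; split=> // r s a b.
by rewrite adjmx1 mul1mx sqnorm_tens mul1r.
Qed.

(** Tensoring the isometries multiplies the overlap with the state by 1 - p, but halves the bound
    for separable states. *)
Lemma has_witness_btens ds (U : 'M[C]_ds) m (rho : 'M[C]_(m * m)) q c :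
  (0 < ds)%N -> flat_unitary U -> 0 <= c -> has_witness rho q c ->
  has_witness (btens rho (rho_state U)) (q * (1 - pparam R ds)) (2^-1 * c).
Proof.
move=> ds0 fU c0 [st pt [k [H [HH tH Hc]]]]; split.
- by apply: is_state_btens => //; exact: is_state_rho.
- by rewrite ptrans_btens pt ptrans_rho.
exists _, (regroup_rows (H *t pbit_isometry U)); split.
- by rewrite regroup_adj_mul adjmx_tens tensmx_mul HH pbit_isometryP // tensmx1.
- rewrite -mulmxA /btens regroup_mul_rows regroup_adj_mul adjmx_tens !tensmx_mul !mulmxA.
  by rewrite mxtrace_tens tH pbit_overlap // rmorphM.
have -> : 2^-1 * c = (Num.sqrt 2)^-1 ^+ 2 * c by rewrite exprVn sqr_sqrtr.
apply: (sep_bounded_twist (w := fun i j => (Num.sqrt (ds%:R : R))%:C * U i j)) => //.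
- exact: sqmod_flat.
- exact: pbit_isometryE.
Qed.

Lemma has_witness_tpow ds (U : 'M[C]_ds) l : (0 < ds)%N -> flat_unitary U ->
  has_witness (tpow (rho_state U) l) ((1 - pparam R ds) ^+ l) (2^-1 ^+ l).
Proof.
move=> ds0 fU; elim: l => [|l IH]; first exact: has_witness1.
rewrite exprSr exprS; apply: (has_witness_cast (esym (expnSr (2 * ds) l))).
by apply: has_witness_btens => //; rewrite exprn_ge0 // invr_ge0.
Qed.

Lemma tpow_rho_far ds (U : 'M[C]_ds) l : (0 < ds)%N -> flat_unitary U ->
  let rho' := tpow (rho_state U) l in
  [/\ is_state rho', is_PPT rho' &
      2 * ((1 - pparam R ds) ^+ l - 2^-1 ^+ l) <= distSEP rho'].
Proof.
move=> ds0 fU rho'; have [st pt [k [H [HH tH Hc]]]] := has_witness_tpow l ds0 fU.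
(* A state equal to its partial transpose is PPT by its own positivity. *)
split=> //; first by rewrite /is_PPT pt; exact: st.1.
by have := distSEP_ge st HH Hc; rewrite tH.
Qed.

End TensorPowers.

(** * Existence of flat unitaries *)

(** The Fourier matrix z^(ij) / sqrt n, with z a primitive n-th root of unity. *)
Lemma exists_flat_unitary (R : realType) n : (0 < n)%N ->
  exists U : 'M[R[i]]_n, flat_unitary U.
Proof.
move=> n0; have [z zP] : exists z : R[i], n.-primitive_root z.
  (* X^n - 1 splits and is separable, so it has n distinct roots, one of which is primitive. *)
  pose p : {poly R[i]} := 'X^n - 1; have [r Dp] := closed_field_poly_normal p.
  rewrite (monicP _) ?monicXnsubC // scale1r in Dp.
  have rn1 : all n.-unity_root r by apply/allP => z; rewrite -root_prod_XsubC -Dp.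
  have sz_r : (n < (size r).+1)%N by rewrite -(size_prod_XsubC r id) -Dp size_XnsubC.
  have [|z] := hasP (has_prim_root n0 rn1 _ sz_r); last by exists z.
  by rewrite -separable_prod_XsubC -Dp separable_Xn_sub_1 // pnatr_eq0 -lt0n.
have zn : `|z| = 1.
  apply/eqP; rewrite -(@pexpr_eq1 _ _ n) // -normrX (prim_expr_order zP) normr1 //.
have zJ : z * conjc z = 1.
  by rewrite -sqr_normc zn expr1n.
have nR : 0 < n%:R :> R by rewrite ltr0n.
pose r : R := (Num.sqrt n%:R)^-1.
have rr : r * r = n%:R^-1 by rewrite -invfM -expr2 sqr_sqrtr // ltW.
pose U : 'M[R[i]]_n := \matrix_(i, j) (r%:C * z ^+ (i * j)).
exists U; split; last first.
  by move=> i j; rewrite mxE normrM normrX zn expr1n mulr1 ger0_norm // ler0c invr_ge0 sqrtr_ge0.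
apply/matrixP => i j; rewrite mxE [RHS]mxE.
(* Entry (i, j) of U U^dag is a geometric sum with ratio [w], an n-th root of unity equal to 1 only
   for i = j. *)
pose w := z ^+ i * conjc z ^+ j.
have -> : \sum_k U i k * adjmx U k j = (n%:R^-1)%:C * \sum_(k < n) w ^+ k.
  rewrite mulr_sumr; apply: eq_bigr => k _.
  have conjE m : conjc (r%:C * z ^+ m) = r%:C * conjc z ^+ m.
    by rewrite rmorphM rmorphXn; congr (_ * _); exact: conjc_real.
  rewrite adjmxE !mxE conjE mulrACA -rmorphM /= rr.
  by rewrite /w exprMn -!exprM.
have wn : w ^+ n = 1.
  by rewrite /w exprMn -!exprM mulnC exprM (prim_expr_order zP) expr1n mul1r mulnC exprM
    -rmorphXn /= (prim_expr_order zP) conjc1 expr1n.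
have [ij|ij] := eqVneq i j.
  rewrite /w ij -exprMn zJ expr1n.
  under eq_bigr do rewrite expr1n.
  rewrite sumr_const card_ord -(rmorph_nat (real_complex R)) -rmorphM /= mulVf ?gt_eqF //.
suff -> : \sum_(k < n) w ^+ k = 0 by rewrite mulr0.
have w1 : w - 1 != 0.
  rewrite subr_eq0; apply: contra ij => /eqP wE; apply/eqP/val_inj/eqP => /=.
  have : z ^+ i = z ^+ j.
    have := congr1 (fun x => x * z ^+ j) wE.
    by rewrite /w mul1r -mulrA -exprMn (mulrC _ z) zJ expr1n mulr1.
  move=> /eqP; rewrite (eq_prim_root_expr zP) => /eqP.
  by rewrite !modn_small // => ->.
by apply: (mulfI w1); rewrite -subrX1 wn subrr mulr0.
Qed.

(** * Estimates for l, ds and the final dimension *)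

Section Dimensions.
Context {R : realType} {eps : R}.
Hypotheses (eps_gt0 : 0 < eps) (eps_lt2 : eps < 2).
Local Notation L := (log2 (4 / eps)).
Local Notation l := (l_of eps).
Local Notation ds := (ds_of eps).

Let ln2_gt0 : 0 < ln (2 : R). Proof. by rewrite ln_gt0 // ltr1n. Qed.

Lemma log2K (x : R) : 0 < x -> 2 `^ log2 x = x.
Proof.
move=> x0; rewrite /powR pnatr_eq0 /= /log2 divfK ?gt_eqF // lnK //.
Qed.

Let four_eps : 2 < 4 / eps.
Proof. rewrite ltr_pdivlMr //. by have := eps_lt2; lra. Qed.

Lemma log2_gt1 : 1 < L.
Proof.
by rewrite /log2 ltr_pdivlMr // mul1r ltr_ln ?posrE // divr_gt0.
Qed.

(** For nonnegative arguments the absolute value in [l_of] and [ds_of] leaves the ceiling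
    unchanged. *)
Lemma natr_ceil_bounds (x : R) : 0 <= x ->
  x <= `|Num.ceil x|%N%:R /\ `|Num.ceil x|%N%:R < x + 1.
Proof.
move=> x0; have c0 : 0 <= Num.ceil x by rewrite ceil_ge0 // (lt_le_trans _ x0) // ltrN10.
rewrite natr_absz ger0_norm // ceil_ge; split=> //.
by rewrite -ltrBlDr ltrBlDr; have := ceil_itv x; rewrite intrB => /andP[]; lra.
Qed.

Lemma l_of_ge : L <= l%:R.
Proof. by have [] := @natr_ceil_bounds L (le_trans ler01 (ltW log2_gt1)). Qed.

(** The ceiling is below L + 1, and L > 1 because eps < 2. *)
Lemma l_of_le : l%:R <= 2 * L.
Proof.
have [_ +] := @natr_ceil_bounds L (le_trans ler01 (ltW log2_gt1)).
by rewrite -/l; have := log2_gt1; lra.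
Qed.

Lemma l_of_gt0 : (0 < l)%N.
Proof. by rewrite -(ltr0n R) (lt_le_trans _ l_of_ge) // (lt_trans ltr01) // log2_gt1. Qed.

Let x := 4 * l%:R / eps.

Let x_gt2 : 2 < x.
Proof.
have l1 : 1 <= l%:R :> R by rewrite ler1n l_of_gt0.
by rewrite /x ltr_pdivlMr //; have := eps_lt2; lra.
Qed.

Lemma ds_of_ge : (x - 1) ^+ 2 <= ds%:R.
Proof. by have [] := natr_ceil_bounds (sqr_ge0 (x - 1)). Qed.

Lemma ds_of_le : ds%:R <= x ^+ 2.
Proof.
have [_ +] := natr_ceil_bounds (sqr_ge0 (x - 1)).
rewrite -/(ds_of eps) => /ltW/le_trans; apply.
by rewrite !expr2; have := x_gt2; nra.
Qed.

Lemma ds_of_gt0 : (0 < ds)%N.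
Proof.
rewrite -(ltr0n R) (lt_le_trans _ ds_of_ge) // exprn_gt0 //.
by have := x_gt2; lra.
Qed.

(** As l <= 2^l <= 2^(2L) and 4/eps = 2^L, one has x <= 2^(3L). With 2 <= 2^L and ds <= x^2 this
    yields 2 ds <= 2^(7L), and l <= 2L gives the exponent 14 L^2. *)
Lemma dim_le : ((2 * ds) ^ l)%:R <= 2 `^ (14 * L ^+ 2).
Proof.
have L1 := log2_gt1.
have x0 : 0 <= x by apply: le_trans (ltW x_gt2).
have x_le : x <= 2 `^ (3 * L).
  have l_le : l%:R <= 2 `^ (2 * L).
    apply: (@le_trans _ _ (2 `^ l%:R)); last by rewrite ler_powR ?ler1n // l_of_le.
    by rewrite powR_mulrn // -natrX ler_nat ltnW // ltn_expl.
  rewrite (_ : 3 * L = L + 2 * L); last by ring.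
  rewrite powRD; last by rewrite pnatr_eq0 implybT.
  rewrite log2K ?divr_gt0 //.
  rewrite /x mulrAC ler_wpM2l // divr_ge0 // ltW //.
have ds_le : (2 * ds)%:R <= 2 `^ (7 * L).
  rewrite (_ : 7 * L = L + 3 * L + 3 * L); last by ring.
  rewrite !powRD ?pnatr_eq0 ?implybT // natrM -mulrA.
  apply: ler_pM => //; first by rewrite log2K ?divr_gt0 // ltW.
  by apply: le_trans ds_of_le _; rewrite expr2 ler_pM.
rewrite natrX (_ : 14 * L ^+ 2 = 7 * L * (2 * L)); last by ring.
rewrite powRrM -powR_mulrn ?powR_ge0 //.
apply: (@le_trans _ _ ((2 `^ (7 * L)) `^ l%:R)).
  by rewrite ge0_ler_powR // nnegrE // powR_ge0.
apply: ler_powR; last exact: l_of_le.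
by rewrite -[leLHS](powRr0 2) ler_powR ?ler1n //; lra.
Qed.

(** The -1 inside the square of [ds_of] is made for this: 1 + sqrt ds >= x = 4 l / eps, so l p <=
    eps / 4. *)
Lemma pparam_le : l%:R * pparam R ds <= eps / 4.
Proof.
have rt : x <= 1 + Num.sqrt (ds%:R : R).
  rewrite -lerBlDl -[x - 1]ger0_norm; last by have := x_gt2; lra.
  by rewrite -sqrtr_sqr ler_sqrt // ds_of_ge.
rewrite /pparam ler_pdivrMr; last by apply: lt_le_trans rt; apply: lt_trans x_gt2.
apply: le_trans (ler_wpM2l _ rt); last by rewrite divr_ge0 // ltW.
by rewrite /x le_eqVlt; apply/orP; left; apply/eqP; field; rewrite gt_eqF.
Qed.

Lemma half_exp_le : 2^-1 ^+ l <= eps / 4 :> R.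
Proof.
rewrite exprVn -[leRHS]invrK lef_pV2 ?posrE ?exprn_gt0 ?invr_gt0 ?divr_gt0 //.
rewrite invf_div -[leLHS]log2K ?divr_gt0 // -powR_mulrn // ler_powR ?ler1n //.
exact: l_of_ge.
Qed.

Lemma bernoulli_inequality (p : R) n : 0 <= p <= 1 -> 1 - n%:R * p <= (1 - p) ^+ n.
Proof.
move=> /andP[p0 p1]; elim: n => [|n IH]; first by rewrite mul0r subr0 expr0.
rewrite exprS; apply: le_trans (ler_wpM2l _ IH); last by rewrite subr_ge0.
have n0 : 0 <= n%:R :> R by [].
by rewrite -natr1; nra.
Qed.

(** Bernoulli gives (1 - p)^l >= 1 - l p >= 1 - eps/4, and 2^-l costs another eps/4; the factor 2
    turns these losses into eps. *)
Lemma witness_gap : 2 - eps <= 2 * ((1 - pparam R ds) ^+ l - 2^-1 ^+ l).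
Proof.
have p01 : 0 <= pparam R ds <= 1.
  rewrite /pparam invr_ge0 addr_ge0 ?sqrtr_ge0 //= invf_le1.
    by rewrite lerDl sqrtr_ge0.
  by rewrite ltr_pwDl // sqrtr_ge0.
have := bernoulli_inequality l p01; have := pparam_le; have := half_exp_le.
by move: (_ ^+ _) (_ ^+ _) (l%:R * _) => a b c; lra.
Qed.

End Dimensions.

Theorem theorem2 (R : realType) :
  exists C : R, 0 < C /\
  forall eps : R, 0 < eps -> eps < 2 ->
    (exists d : nat,
       (d%:R <= 2 `^ (C * (log2 (4 / eps)) ^+ 2)) /\
       exists rho' : 'M[R[i]]_(d * d),
         [/\ is_state rho', is_PPT rho' & 2 - eps <= distSEP rho'])
    /\
    (let l := l_of eps in let ds := ds_of eps in
     ((2 * ds) ^ l)%:R <= 2 `^ (C * (log2 (4 / eps)) ^+ 2) /\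
     forall U : 'M[R[i]]_ds, flat_unitary U ->
       let rho' := tpow (rho_state U) l in
       [/\ is_state rho', is_PPT rho' & 2 - eps <= distSEP rho']).
Proof.
(* The exponent constant of [dim_le]. *)
exists 14; split=> // eps eps0 eps2.
have main (U : 'M[R[i]]_(ds_of eps)) : flat_unitary U ->
    let rho' := tpow (rho_state U) (l_of eps) in
    [/\ is_state rho', is_PPT rho' & 2 - eps <= distSEP rho'].
  move=> fU rho'; have [? ? far] := tpow_rho_far (l_of eps) (ds_of_gt0 eps0 eps2) fU.
  by split=> //; exact: le_trans (witness_gap eps0 eps2) far.
split; last by split=> //; exact: dim_le.
exists ((2 * ds_of eps) ^ l_of eps)%N; split; first exact: dim_le.
(* The existence claim is the explicit construction applied to a Fourier matrix. *)
have [U fU] := exists_flat_unitary R (ds_of_gt0 eps0 eps2).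
by exists (tpow (rho_state U) (l_of eps)); exact: main.
Qed.
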